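(* Consider the single stage pricing game with additive loyalty described in the context, with parameters $c_A\ge c_B\ge 0$, $s_\alpha,s_\beta\ge0$, $\theta\in(0,1)$, and $F$ the distribution function of the uniform distribution on $[0,1]$. Suppose (Region II) $$\max(1-s_\beta,\;s_\alpha-1)\le c_A-c_B\le s_\alpha+2 .$$ Then the game has a unique pure Nash equilibrium, and its prices are $$p_A^\alpha=\tfrac13(2c_A+c_B+s_\alpha+2),\quad p_A^\beta=c_A,\quad p_B^\beta=c_A+s_\beta,\quad p_B^\alpha=\tfrac13(c_A+2c_B-s_\alpha+1) .$$
   Context: Two firms $A$ and $B$ sell the same product, with unit product costs $c_A$ and $c_B$, where $c_A\ge c_B\ge 0$. Customers are partitioned into a set $\alpha$ (ex ante loyal to $A$; a fraction $\theta$ of the market) and a set $\beta$ (ex ante loyal to $B$; a fraction $1-\theta$). Both firms can tell the two sets apart. Each customer buys exactly one unit, from $A$ or from $B$. Firms move simultaneously: $A$ chooses $(p_A^\alpha,p_A^\beta)$ with $p_A^\alpha,p_A^\beta\ge c_A$, and $B$ chooses $(p_B^\beta,p_B^\alpha)$ with $p_B^\beta,p_B^\alpha\ge c_B$; the superscript is the set of customers to which the price is offered. Additive loyalty: a customer in $\alpha$ has loyalty level $\xi+s_\alpha$ and buys from $A$ iff $\xi+s_\alpha\ge p_A^\alpha-p_B^\alpha$; a customer in $\beta$ has loyalty level $\xi+s_\beta$ and buys from $B$ iff $\xi+s_\beta\ge p_B^\beta-p_A^\beta$; here $\xi$ is random with distribution function $F$. Put $\xi^\alpha=p_A^\alpha-p_B^\alpha-s_\alpha$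 and $\xi^\beta=p_B^\beta-p_A^\beta-s_\beta$. For the uniform distribution, $F(x)=0$ for $x\le 0$, $F(x)=x$ for $0\le x\le1$, $F(x)=1$ for $x\ge1$. Profits: firm $A$ gets $(p_A^\alpha-c_A)\,\theta\,(1-F(\xi^\alpha))+(p_A^\beta-c_A)(1-\theta)F(\xi^\beta)$; firm $B$ gets $(p_B^\beta-c_B)(1-\theta)(1-F(\xi^\beta))+(p_B^\alpha-c_B)\,\theta\,F(\xi^\alpha)$. A pure Nash equilibrium is a price profile $(p_A^\alpha,p_A^\beta,p_B^\beta,p_B^\alpha)$ from which neither firm can strictly increase its profit by unilaterally changing its own (feasible) prices. *)

(* Defs.v *)
From mathcomp Require Import all_boot all_order all_algebra reals.

Set Implicit Arguments.
Unset Strict Implicit.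
Unset Printing Implicit Defensive.

Import Order.TTheory GRing.Theory Num.Theory.
Local Open Scope ring_scope.

Definition uniform_cdf (R : realType) (x : R) : R :=
  if x <= 0 then 0 else if x <= 1 then x else 1.

(* [theta] is the fraction of customers that are ex ante loyal to A (the set
   alpha); the remaining fraction [1 - theta] is the set beta. *)
Record market (R : realType) := Market {
  cost_A : R;
  cost_B : R;
  s_alpha : R;
  s_beta : R;
  theta : R
}.

(* A strategy of either firm: the price offered to each set of customers. *)
Record offer (R : realType) := Offer {
  to_alpha : R;
  to_beta : R
}.

Definition feasible (R : realType) (c : R) (p : offer R) : Prop :=
  c <= to_alpha p /\ c <= to_beta p.

Section Game.
Variables (R : realType) (F : R -> R) (M : market R).
Implicit Types (pA pB : offer R).

(* A customer of alpha with loyalty xi + s_alpha buys from A iff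
   xi >= xi_alpha pA pB, so A keeps the fraction 1 - F (xi_alpha pA pB) of
   alpha; symmetrically for B and beta. *)
Definition xi_alpha pA pB : R := to_alpha pA - to_alpha pB - s_alpha M.

Definition xi_beta pA pB : R := to_beta pB - to_beta pA - s_beta M.

Definition profit_A pA pB : R :=
  (to_alpha pA - cost_A M) * theta M * (1 - F (xi_alpha pA pB)) +
  (to_beta pA - cost_A M) * (1 - theta M) * F (xi_beta pA pB).

Definition profit_B pA pB : R :=
  (to_beta pB - cost_B M) * (1 - theta M) * (1 - F (xi_beta pA pB)) +
  (to_alpha pB - cost_B M) * theta M * F (xi_alpha pA pB).

Definition pure_nash (e : offer R * offer R) : Prop :=
  let: (pA, pB) := e in
  [/\ feasible (cost_A M) pA,
      feasible (cost_B M) pB,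
      forall pA', feasible (cost_A M) pA' -> profit_A pA' pB <= profit_A pA pB &
      forall pB', feasible (cost_B M) pB' -> profit_B pA pB' <= profit_B pA pB].

End Game.

(* Main.v *)
(* The market splits into alpha and beta, and in each of them a firm with
   margin x over its cost earns x * F (w - x), where w depends only on the
   price of its rival. If w > 0, the unique maximizer over x >= 0 is
   max (w / 2) (w - 1); if w <= 0, every x earns 0. An equilibrium is therefore
   a solution of two piecewise linear systems of mutual best replies. *)

Require Import Defs.
From mathcomp Require Import all_boot all_order all_algebra reals.
From mathcomp Require Import ring lra.

Set Implicit Arguments.
Unset Strict Implicit.
Unset Printing Implicit Defensive.

Import Order.TTheory GRing.Theory Num.Theory.
Local Open Scope ring_scope.

Section BestReply.
Variable R : realType.
Implicit Types (c p q w x y z : R).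
Local Notation F := (@uniform_cdf R).

(** The uniform law on [0, 1] is symmetric about 1/2; this puts the share that a firm keeps of its
    own loyal customers in the form F (w - x). *)
Lemma uniform_cdf_compl z : 1 - F z = F (1 - z).
Proof.
rewrite /uniform_cdf.
by case: (lerP z 0); case: (lerP z 1); case: (lerP (1 - z) 0);
  case: (lerP (1 - z) 1); lra.
Qed.

Definition margin_profit w x := x * F (w - x).

Definition best_reply w := Num.max (w / 2) (w - 1).

Definition maximizes w x :=
  0 <= x /\ forall y, 0 <= y -> margin_profit w y <= margin_profit w x.

(** The vertex w / 2 of x (w - x) and the largest margin w - 1 at which every customer is served
    cross at w = 2. *)
Lemma margin_profit_best_reply w : 0 < w ->
  margin_profit w (best_reply w) = if w <= 2 then (w / 2) ^+ 2 else w - 1.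
Proof.
move=> w0; rewrite /margin_profit /best_reply /uniform_cdf.
by case: (lerP w 2) => w2; case: (lerP (w / 2) (w - 1)) => wb;
  case: lerP => h0; try case: lerP => h1; nra.
Qed.

Lemma margin_profit_lt w x : 0 < w -> 0 <= x -> x != best_reply w ->
  margin_profit w x < margin_profit w (best_reply w).
Proof.
move=> w0 x0; rewrite margin_profit_best_reply // /best_reply => xb.
have [w2|w2] := lerP w 2.
  (* This square is exactly the gap between (w / 2)^2 and x (w - x). *)
  have xw : 0 < (x - w / 2) ^+ 2.
    rewrite exprn_even_gt0 //= subr_eq0; apply: contraNneq xb => ->.
    by rewrite max_l //; lra.
  rewrite /margin_profit /uniform_cdf.
  case: (lerP (w - x) 0) => h0; first by rewrite mulr0 exprn_gt0 // divr_gt0.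
  case: (lerP (w - x) 1) => h1; first by nra.
  (* Here F = 1, and the profit x is at most x (w - x), which lies below the vertex value. *)
  have : 0 <= x * (w - x - 1) by rewrite mulr_ge0 //; lra.
  nra.
have xw : x - (w - 1) != 0.
  by rewrite subr_eq0; apply: contraNneq xb => ->; rewrite max_r //; lra.
rewrite /margin_profit /uniform_cdf.
case: (lerP (w - x) 0) => h0; first by lra.
case: (lerP (w - x) 1) => h1; last by lra.
(* The gap (w - 1) - x (w - x) factors as (x - 1) (x - (w - 1)), and both factors are positive since
   w > 2. *)
have : 0 < x - (w - 1) by rewrite lt0r xw /=; lra.
nra.
Qed.

Lemma best_reply_ge0 w : 0 <= w -> 0 <= best_reply w.
Proof. by move=> w0; rewrite le_max divr_ge0. Qed.

Lemma maximizesP w x : 0 < w -> maximizes w x <-> x = best_reply w.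
Proof.
move=> w0; split=> [[x0 xmax]|->].
  apply/eqP; apply: contraT => xb.
  have := xmax _ (best_reply_ge0 (ltW w0)).
  by rewrite leNgt margin_profit_lt.
split=> [|y y0]; first exact: best_reply_ge0 (ltW w0).
have [->//|yb] := eqVneq y (best_reply w).
exact/ltW/margin_profit_lt.
Qed.

Lemma maximizes_le0 w x : w <= 0 -> 0 <= x -> maximizes w x.
Proof.
move=> w0 x0; split=> // y y0.
by rewrite /margin_profit /uniform_cdf !ifT ?mulr0 //; lra.
Qed.

(** The degenerate case w = 0 is included because it occurs at the ends m = -1 and m = 2 of
    [shared_segment]. *)
Lemma maximizes_best_reply w : 0 <= w -> maximizes w (best_reply w).
Proof.
rewrite le0r => /orP[/eqP->|w0]; last exact/maximizesP.
by apply: maximizes_le0 => //; exact: best_reply_ge0.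
Qed.

(** A firm prices its two segments independently: varying one margin with the other held fixed
    cancels one term, then the positive weight. *)
Lemma maximizes_sum p q v w x y : 0 < p -> 0 < q ->
  (maximizes v x /\ maximizes w y) <->
  [/\ 0 <= x, 0 <= y & forall x' y', 0 <= x' -> 0 <= y' ->
     p * margin_profit v x' + q * margin_profit w y' <=
     p * margin_profit v x + q * margin_profit w y].
Proof.
move=> p0 q0; split=> [[[x0 xmax] [y0 ymax]]|[x0 y0 xymax]].
  split=> // x' y' x'0 y'0.
  by apply: lerD; rewrite ler_pM2l //; [exact: xmax | exact: ymax].
split; split=> // z z0.
  by have := xymax _ _ z0 y0; rewrite lerD2r ler_pM2l.
by have := xymax _ _ x0 z0; rewrite lerD2l ler_pM2l.
Qed.

End BestReply.

Section Segments.
Variables (R : realType) (M : market R).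
Implicit Types pA pB : offer R.
Local Notation F := (@uniform_cdf R).

Let mA (p : R) := p - cost_A M.
Let mB (p : R) := p - cost_B M.
(** Each w is chosen so that the firm's share of the segment is F (w - margin); the summand 1 on the
    loyal side comes from [uniform_cdf_compl]. *)
Let wA_alpha pB := 1 + to_alpha pB + s_alpha M - cost_A M.
Let wA_beta pB := to_beta pB - s_beta M - cost_A M.
Let wB_beta pA := 1 + to_beta pA + s_beta M - cost_B M.
Let wB_alpha pA := to_alpha pA - s_alpha M - cost_B M.

Lemma profit_A_margins pA pB : profit_A F M pA pB =
  theta M * margin_profit (wA_alpha pB) (mA (to_alpha pA)) +
  (1 - theta M) * margin_profit (wA_beta pB) (mA (to_beta pA)).
Proof.
rewrite /profit_A /margin_profit uniform_cdf_compl /xi_alpha /xi_beta.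
rewrite /mA /wA_alpha /wA_beta !mulrA ![_ * (_ - cost_A M)]mulrC.
by congr (_ * F _ + _ * F _); ring.
Qed.

Lemma profit_B_margins pA pB : profit_B F M pA pB =
  (1 - theta M) * margin_profit (wB_beta pA) (mB (to_beta pB)) +
  theta M * margin_profit (wB_alpha pA) (mB (to_alpha pB)).
Proof.
rewrite /profit_B /margin_profit uniform_cdf_compl /xi_alpha /xi_beta.
rewrite /mB /wB_alpha /wB_beta !mulrA ![_ * (_ - cost_B M)]mulrC.
by congr (_ * F _ + _ * F _); ring.
Qed.

Lemma pure_nash_segments pA pB : 0 < theta M -> theta M < 1 ->
  pure_nash F M (pA, pB) <->
  (maximizes (wA_alpha pB) (mA (to_alpha pA)) /\
   maximizes (wA_beta pB) (mA (to_beta pA))) /\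
  (maximizes (wB_beta pA) (mB (to_beta pB)) /\
   maximizes (wB_alpha pA) (mB (to_alpha pB))).
Proof.
move=> th0 th1; have th1' : 0 < 1 - theta M by rewrite subr_gt0.
rewrite (maximizes_sum _ _ _ _ th0 th1') (maximizes_sum _ _ _ _ th1' th0).
rewrite /mA /mB !subr_ge0; split.
  case=> -[Aa Ab] [Ba Bb] Amax Bmax; split; split=> // x y x0 y0.
    have := Amax (Offer (x + cost_A M) (y + cost_A M)).
    rewrite !profit_A_margins /mA /= !addrK; apply.
    by split; rewrite /= lerDr.
  have := Bmax (Offer (y + cost_B M) (x + cost_B M)).
  rewrite !profit_B_margins /mB /= !addrK; apply.
  by split; rewrite /= lerDr.
case=> -[Aa Ab Amax] [Bb Ba Bmax]; split=> // p [pa pb].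
  by rewrite !profit_A_margins; apply: Amax; rewrite subr_ge0.
by rewrite !profit_B_margins; apply: Bmax; rewrite subr_ge0.
Qed.

End Segments.

Section MutualBestReplies.
Variable R : realType.
Implicit Types m k x y : R.

(* [m] is cost_A - cost_B - s_alpha. *)
Lemma shared_segment m x y : -1 <= m -> m <= 2 ->
  maximizes (y + 1 - m) x /\ maximizes (x + m) y <->
  x = (2 - m) / 3 /\ y = (1 + m) / 3.
Proof.
move=> m1 m2; split=> [[Hx Hy]|[-> ->]].
  have [x0 _] := Hx; have [y0 _] := Hy.
  (* If A's w is nonpositive, only B's reply carries information; with x >= 0 it forces m = 2, where
     the formulas still hold. The mirror case for B forces m = -1. *)
  have [wx|wx] := lerP (y + 1 - m) 0.
    have /maximizesP Ey : 0 < x + m by lra.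
    move: Hy => /Ey; rewrite /best_reply.
    by case: (lerP ((x + m) / 2)) => ? ?; split; lra.
  have [wy|wy] := lerP (x + m) 0.
    move: Hx => /(maximizesP _ wx); rewrite /best_reply.
    by case: (lerP ((y + 1 - m) / 2)) => ? ?; split; lra.
  (* With both w positive, any combination involving a corner reply is contradictory; the two
     interior replies give the linear system solved here. *)
  move: Hx Hy => /(maximizesP _ wx) + /(maximizesP _ wy); rewrite /best_reply.
  by case: (lerP ((y + 1 - m) / 2)) => ?; case: (lerP ((x + m) / 2)) => ? ? ?;
    split; lra.
set w := _ + 1 - m; set v := _ + m.
have -> : (2 - m) / 3 = best_reply w.
  by rewrite /best_reply max_l /w; lra.
have -> : (1 + m) / 3 = best_reply v.
  by rewrite /best_reply max_l /v; lra.
by split; apply: maximizes_best_reply; rewrite /w /v; lra.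
Qed.

(* [k] is cost_A - cost_B + s_beta, [x] the margin of A and [y] that of B. *)
Lemma captured_segment k x y : 1 <= k ->
  maximizes (y - k) x /\ maximizes (x + k + 1) y <-> x = 0 /\ y = k.
Proof.
move=> k1; split=> [[Hx Hy]|[-> ->]].
  have [x0 _] := Hx.
  (* B's w is at least 2, so B replies at the corner w - 1 and takes the whole segment. *)
  have /maximizesP Ey : 0 < x + k + 1 by lra.
  have y_xk : y = x + k.
    by move: Hy => /Ey ->; rewrite /best_reply max_r; lra.
  suff x_eq0 : x = 0 by rewrite y_xk x_eq0 add0r.
  (* A's w is now x itself, and for x > 0 both x / 2 and x - 1 lie below x, so x is not a reply to
     itself. *)
  apply/eqP; apply: contraT => x_neq0.
  have x_gt0 : 0 < x by rewrite lt0r x_neq0.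
  move: Hx; rewrite y_xk addrK => /(maximizesP _ x_gt0); rewrite /best_reply.
  by case: (lerP (x / 2)) => ? ?; lra.
(* At y = k, A's w is 0: no nonnegative margin earns A anything, so 0 is optimal. *)
split; first by apply: maximizes_le0; lra.
by apply/maximizesP; [lra | rewrite /best_reply max_r; lra].
Qed.

End MutualBestReplies.

Theorem proposition16 (R : realType) (cA cB sa sb th : R)
    (hcB : 0 <= cB) (hcAB : cB <= cA)
    (hsa : 0 <= sa) (hsb : 0 <= sb)
    (hth0 : 0 < th) (hth1 : th < 1)
    (hlow : Num.max (1 - sb) (sa - 1) <= cA - cB)
    (hupp : cA - cB <= sa + 2) :
  let M := {| cost_A := cA; cost_B := cB;
              s_alpha := sa; s_beta := sb; theta := th |} in
  let pA := {| to_alpha := 3^-1 * (2 * cA + cB + sa + 2);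
               to_beta := cA |} in
  let pB := {| to_alpha := 3^-1 * (cA + 2 * cB - sa + 1);
               to_beta := cA + sb |} in
  pure_nash (@uniform_cdf R) M (pA, pB) /\
  (forall qA qB : offer R,
     pure_nash (@uniform_cdf R) M (qA, qB) -> qA = pA /\ qB = pB).
Proof.
move=> M pA pB; move: hlow; rewrite ge_max => /andP[hb ha].
have nashP qA qB : pure_nash (@uniform_cdf R) M (qA, qB) <-> qA = pA /\ qB = pB.
  rewrite pure_nash_segments //=.
  rewrite /pA /pB; case: qA qB => [aA bA] [aB bB] /=.
  (* The region splits by segment: the bounds with [sa] make alpha shared, and the bound with [sb]
     makes B capture beta. *)
  have m1 : -1 <= cA - cB - sa by lra.
  have m2 : cA - cB - sa <= 2 by lra.
  have k1 : 1 <= cA - cB + sb by lra.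
  have alphaP := shared_segment (aA - cA) (aB - cB) m1 m2.
  have betaP := captured_segment (bA - cA) (bB - cB) k1.
  have eA : aB - cB + 1 - (cA - cB - sa) = 1 + aB + sa - cA by ring.
  have eB : aA - cA + (cA - cB - sa) = aA - sa - cB by ring.
  have fA : bB - cB - (cA - cB + sb) = bB - sb - cA by ring.
  have fB : bA - cA + (cA - cB + sb) + 1 = 1 + bA + sb - cB by ring.
  rewrite eA eB in alphaP; rewrite fA fB in betaP.
  split=> [[[Aa Ab] [Bb Ba]]|[[aAE bAE] [aBE bBE]]].
    have [? ?] := alphaP.1 (conj Aa Ba); have [? ?] := betaP.1 (conj Ab Bb).
    by split; congr Offer; lra.
  have [|Aa Ba] := alphaP.2 _; first by split; lra.
  have [|Ab Bb] := betaP.2 _; first by split; lra.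
  by [].
by split=> [|qA qB]; [exact/nashP | move/nashP].
Qed.
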